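(* Let $\alpha\in(2,\infty)\setminus\mathbb{Z}$ and let $k\ge 2$ be a fixed integer. In the Chung--Lu random graph on $n\ge k$ nodes with i.i.d. weights having tail $\overline{F}(h)=\mathbb{P}(H>h)=h^{1-\alpha}l(h)$, $h\ge 1$, where $l$ is a fixed slowly varying function, let $K_k$ be the event that the nodes $\{1,2,\ldots,k\}$ form a clique. Then, as $n\to\infty$, $$\mathbb{P}(K_k)\asymp\begin{cases} n^{\frac{k}{2}(1-k)} & \text{when } k<\alpha,\\ n^{\frac{k}{2}(1-\alpha)}\,l(\sqrt{n})^{k} & \text{when } k>\alpha.\end{cases}$$
   Context: Model (Chung--Lu variant of the rank-1 inhomogeneous random graph). There are $n$ nodes $1,\ldots,n$. Node $i$ has weight $H_i$, where $(H_1,\ldots,H_n)$ are i.i.d. copies of a random variable $H$ taking values in $[1,\infty)$ with $\overline{F}(h)=\mathbb{P}(H>h)=h^{1-\alpha}l(h)$ for $h\ge 1$, where $\alpha>2$ and $l$ is a (positive) slowly varying function, i.e. $\lim_{x\to\infty} l(\lambda x)/l(x)=1$ for every $\lambda>0$. Put $\mu=\mathbb{E}(H)$. Conditional on the weights being $h_1,\ldots,h_n$, each pair of distinct nodes $(i,j)$ is joined by an edge, independently of everything else, with probability $p_{i,j}=\min\{h_ih_j/(\mu n),1\}$. The parameters $\alpha,\mu,k$ and the function $l$ are fixed as $n\to\infty$. A set of nodes forms a clique if all pairs of distinct nodes in it are joined by edges. Notation: $f(n)\asymp g(n)$ means there exist $n_0\ge 0$ and constants $0<C_1<C_2<\infty$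 such that $C_1g(n)\le f(n)\le C_2g(n)$ for all $n>n_0$. *)

(* Defs.v *)
From HB Require Import structures.
From mathcomp Require Export all_boot all_order all_algebra.
From mathcomp Require Export all_classical all_reals all_analysis.

Set Implicit Arguments.
Unset Strict Implicit.
Unset Printing Implicit Defensive.

Export Order.TTheory GRing.Theory Num.Theory.
Export numFieldNormedType.Exports.

Local Open Scope classical_set_scope.
Local Open Scope ring_scope.

Definition slowly_varying (R : realType) (l : R -> R) : Prop :=
  forall lam : R, 0 < lam -> l (lam * x) / l x @[x --> +oo] --> (1 : R).

Definition asymp_same_order (R : realType) (f g : nat -> R) : Prop :=
  exists (n0 : nat) (C1 C2 : R),
    [/\ 0 < C1, C1 < C2 &
      forall n : nat, (n0 < n)%N -> C1 * g n <= f n <= C2 * g n].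

(* Mutual independence: product rule over every subfamily [J]. *)
Definition mutually_independent (R : realType) (d : measure_display)
    (T : measurableType d) (P : probability T R) (n : nat)
    (W : 'I_n -> {RV P >-> R}) : Prop :=
  forall (J : {set 'I_n}) (B : 'I_n -> set R),
    (forall i, measurable (B i)) ->
    P [set w | forall i, i \in J -> B i (W i w)] =
    (\prod_(i in J) P (W i @^-1` B i))%E.

Definition iid_copies (R : realType) (d0 : measure_display)
    (T0 : measurableType d0) (Q : probability T0 R) (H : {RV Q >-> R})
    (d : measure_display) (T : measurableType d) (P : probability T R)
    (n : nat) (W : 'I_n -> {RV P >-> R}) : Prop :=
  mutually_independent W /\
  (forall (i : 'I_n) (B : set R), measurable B ->
     distribution P (W i) B = distribution Q H B).

Definition edge_prob (R : realType) (mu : R) (n : nat) (x y : R) : R :=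
  Num.min (x * y / (mu * n%:R)) 1.

Definition edges_present (T : Type) (n : nat) (G : T -> rel 'I_n)
    (S : {set 'I_n * 'I_n}) : set T :=
  [set w | forall e, e \in S -> G w e.1 e.2].

(* [G w] is the adjacency relation of the random graph at the outcome [w].
   An unordered pair of distinct nodes is represented by the ordered pair [e]
   with [e.1 < e.2]. The last field says that, given the sigma-algebra
   generated by the weights, the edge events are mutually independent with
   probabilities [edge_prob]: for every finite set [S] of pairs, the product of
   the edge probabilities is a version of the conditional probability that all
   pairs in [S] are joined, i.e. it has the right integral over each event [A]
   of that sigma-algebra. *)
Record chung_lu (R : realType) (d0 : measure_display)
    (T0 : measurableType d0) (Q : probability T0 R) (H : {RV Q >-> R})
    (d : measure_display) (T : measurableType d) (P : probability T R)
    (n : nat) (W : 'I_n -> {RV P >-> R}) (G : T -> rel 'I_n) : Prop := ChungLu {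
  cl_weights : iid_copies H W ;
  cl_sym : forall w, symmetric (G w) ;
  cl_irr : forall w, irreflexive (G w) ;
  cl_meas : forall i j, measurable [set w | G w i j] ;
  cl_edges : forall S : {set 'I_n * 'I_n},
    (forall e, e \in S -> (e.1 < e.2)%N) ->
    forall A : set T, g_sigma_preimage W A ->
    P (A `&` edges_present G S) =
    (\int[P]_(w in A)
      (\prod_(e in S)
         edge_prob (fine 'E_Q[H]) n (W e.1 w) (W e.2 w))%:E)%E
}.

Definition is_clique (n : nat) (g : rel 'I_n) (U : {set 'I_n}) : Prop :=
  forall i j, i \in U -> j \in U -> i != j -> g i j.

Definition first_nodes (n k : nat) : {set 'I_n} := [set i : 'I_n | (i < k)%N].

Definition clique_event (T : Type) (n : nat) (G : T -> rel 'I_n) (k : nat) :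
    set T :=
  [set w | is_clique (G w) (first_nodes n k)].

(* Main.v *)
Require Import Defs.
From mathcomp Require Import finmap ring lra measurable_realfun.

Set Implicit Arguments.
Unset Strict Implicit.
Unset Printing Implicit Defensive.

Import HBNNSimple.

(** Put [r = alpha - 1], let [F] be the tail of [H], [s = sqrt (mu n)] and
    [x i = W i / s], so that an edge has conditional probability
    [min (x i * x j) 1]. The probability of a clique on [k] nodes is the
    expectation of the product of these numbers over the [k (k - 1) / 2] pairs
    ([prob_cliqueE]). Almost surely all weights are at least [1].

    The lower bounds keep one scenario ([prob_clique_ge]). If [k < alpha] it is
    the almost sure event that all weights are at least [1]: each pair gives at
    least [1 / s ^ 2], and the product is [s ^ (k (1 - k))]. If [k > alpha] it
    is the event that all [k] weights exceed [s]: all edges are then present,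
    and the event has probability [F s ^ k].

    The upper bounds rest on a deterministic inequality
    [\prod min (x i * x j) 1 <= \prod g (x i)], which separates the variables:
    by independence the clique probability is then at most the [k]-th power of
    the expectation of [g (H / s)] ([integral_prod_le], [prob_clique_le]).

    - If [k < alpha], take [g x = x ^ (k - 1)], which bounds each minimum by the
      product. The moment of order [k - 1 < r] of [H] is finite, so the
      expectation is of order [s ^ (1 - k)].

    - If [k > alpha], take [g x = x ^ p] for [x <= 1] and [g x = x ^ q] for
      [x > 1], with [q < r < p]. The truncated moments of a regularly varying
      tail of index [- r] satisfy [E (H ^ p; H <= s) = O (s ^ p F s)] and
      [E (H ^ q; H > s) = O (s ^ q F s)], so the expectation of [g (H / s)] is
      [O (F s)], matching the lower bound [F s ^ k].

    The inequality in the second case ([prod_min1_le_two_powers]) comes from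
    [min y 1 <= y ^ w] for every [w] in [[0, 1]]: a symmetric choice of weights
    [w i j] on the pairs bounds the product by the product of the powers of
    [x i] of order [\sum_(j != i) w i j]. Let [a] be the number of [x i] that
    are at most [1]. Pairs of two such nodes receive weight [1], mixed pairs a
    common weight [theta], the others [0]. The weighted degrees are then
    [a - 1 + (k - a) theta], which should be at least [p], and [a theta], which
    should be at most [q]; such a [theta] exists as soon as
    [a (p - a + 1) <= (k - a) q]. For [p = q = r] this reads
    [a ^ 2 - (2 r + 1) a + k r >= 0]; its left side is least, among the
    integers, at [a = m + 1] with [m] the integral part of [r], where it is at
    least [m (m + 1 - r)]. This is positive because [alpha] is not an integer,
    which leaves room to separate [p] and [q] ([critical_exponents]).

    The truncated moments are controlled dyadically: slow variation gives
    [F (2 x) <= 2 ^ (- rho) F x] for every [rho < r] and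
    [F x <= 2 ^ rho F (2 x)] for every [rho > r], for [x] large, and both
    estimates follow by adding up the bands [u < H <= 2 u]. *)

Local Open Scope classical_set_scope.
Local Open Scope ring_scope.

(** * Products over pairs of nodes *)

Definition node_pairs (n : nat) (U : {set 'I_n}) : {set 'I_n * 'I_n} :=
  [set e | [&& e.1 \in U, e.2 \in U & (e.1 < e.2)%N]]%SET.

(** Passage from unordered pairs to ordered ones: the two factors attached to a
    pair [i < j] are the terms [(i, j)] and [(j, i)] of the double product. *)
Lemma prod_node_pairs (R : comNzRingType) (n : nat) (U : {set 'I_n})
    (f : 'I_n -> 'I_n -> R) :
  \prod_(e in node_pairs U) (f e.1 e.2 * f e.2 e.1) =
  \prod_(i in U) \prod_(j in U :\ i) f i j.
Proof.
rewrite pair_big_dep /= [RHS](bigID (fun e : 'I_n * 'I_n => (e.1 < e.2)%N)) /=.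
rewrite big_split /=.
congr (_ * _).
  apply: eq_bigl => -[i j]; rewrite !inE /= [RHS]andbAC -!andbA.
  have [ij|_] := boolP (i < j)%N; last by rewrite !andbF.
  by rewrite -(inj_eq val_inj) /= gtn_eqF // andbT andbC.
rewrite (reindex_inj (h := fun e : 'I_n * 'I_n => (e.2, e.1))) /=; last first.
  by move=> [a b] [c e] [-> ->].
apply: eq_bigl => -[i j]; rewrite !inE /= -leqNgt.
rewrite ltn_neqAle -(inj_eq val_inj) /=.
by case: (i \in U); rewrite ?andbF //= [RHS]andbAC [RHS]andbC.
Qed.

Lemma powR_sum (R : realType) (I : finType) (D : {set I}) (x : R)
    (w : I -> R) :
  0 < x -> x `^ (\sum_(i in D) w i) = \prod_(i in D) x `^ w i.
Proof.
move=> x0; apply: (big_morph (fun y => x `^ y) (id1 := 1) (op1 := *%R)); last first.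
  by rewrite powRr0.
by move=> a b; rewrite powRD // (gt_eqF x0) implybT.
Qed.

Lemma min1_le_powR (R : realType) (x w : R) :
  0 < x -> 0 <= w <= 1 -> Num.min x 1 <= x `^ w.
Proof.
move=> x0 /andP[w0 w1]; case: (leP x 1) => x1.
  by apply: ger1_powR => //; rewrite x0.
by rewrite -(powRr0 x) ler_powR // ltW.
Qed.

(** The exponent of [x i] is the degree of [i] in the weighted graph [w]. The
    freedom in the choice of [w] is what makes the bound sharp for every
    configuration of the [x i]. *)
Lemma prod_min1_le_weighted (R : realType) (n : nat) (U : {set 'I_n})
    (x : 'I_n -> R) (w : 'I_n -> 'I_n -> R) :
  (forall i, i \in U -> 0 < x i) ->
  (forall i j, w i j = w j i) -> (forall i j, 0 <= w i j <= 1) ->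
  \prod_(e in node_pairs U) Num.min (x e.1 * x e.2) 1 <=
  \prod_(i in U) x i `^ (\sum_(j in U :\ i) w i j).
Proof.
move=> x0 wC w01.
under [leRHS]eq_bigr => i iU do rewrite powR_sum ?x0 //.
rewrite -prod_node_pairs; apply: ler_prod => -[i j].
rewrite inE /= => /and3P[/x0 xi /x0 xj _].
rewrite le_min ler01 (mulr_ge0 (ltW xi) (ltW xj)) /=.
rewrite [w j i]wC -(powRM _ (ltW xi) (ltW xj)).
by apply: min1_le_powR => //; exact: mulr_gt0.
Qed.

Lemma prod_min1_le_complete (R : realType) (n : nat) (U : {set 'I_n})
    (x : 'I_n -> R) : (forall i, i \in U -> 0 < x i) ->
  \prod_(e in node_pairs U) Num.min (x e.1 * x e.2) 1 <=
  \prod_(i in U) x i `^ (#|U|%:R - 1).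
Proof.
move=> x0.
apply: le_trans (@prod_min1_le_weighted _ _ U x (fun _ _ => 1) x0 _ _) _ => //.
  by move=> i j; rewrite ler01 lexx.
rewrite le_eqVlt; apply/orP; left; apply/eqP; apply: eq_bigr => i iU.
congr (_ `^ _); rewrite sumr_const.
by have := cardsD1 i U; rewrite iU => ->; rewrite natrD addrAC subrr add0r.
Qed.

Definition two_powers (R : realType) (p q x : R) : R :=
  if x <= 1 then x `^ p else x `^ q.

(** The weights are [1] between two nodes with [x i <= 1], [theta] between such a
    node and one with [x i > 1], and [0] otherwise. Since a larger exponent
    decreases [x ^ d] for [x <= 1] and increases it for [x > 1], it suffices that
    the degrees are at least [p] on the first class and at most [q] on the
    second. The hypothesis says that some [theta] achieves both; for [a = #|U|] it
    reduces to [p <= #|U| - 1], which is needed when the second class is empty. *)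
Lemma prod_min1_le_two_powers (R : realType) (n : nat) (U : {set 'I_n})
    (p q : R) (x : 'I_n -> R) :
  (0 < #|U|)%N -> 0 <= q ->
  (forall a : nat, (a <= #|U|)%N ->
     a%:R * (p - a%:R + 1) <= (#|U|%:R - a%:R) * q) ->
  (forall i, i \in U -> 0 < x i) ->
  \prod_(e in node_pairs U) Num.min (x e.1 * x e.2) 1 <=
  \prod_(i in U) two_powers p q (x i).
Proof.
move=> U0 q0 pq x0; set k : R := #|U|%:R.
have k0 : 0 < k by rewrite ltr0n.
pose c i := x i <= 1.
pose an := #|[set i in U | c i]%SET|; pose a : R := an%:R.
have leak : (an <= #|U|)%N.
  by apply: subset_leq_card; apply/fintype.subsetP => i; rewrite inE => /andP[].
have ak : a <= k by rewrite ler_nat.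
have a0 : 0 <= a by [].
have pk : p <= k - 1.
  by have := pq _ (leqnn _); rewrite -/k subrr mul0r pmulr_rle0 //; lra.
have pqa := pq _ leak; rewrite -/k -/a in pqa.
(* The least weight that gives the small nodes degree at least [p]. When all
   nodes are small the quotient is [0] by convention, which is harmless. *)
pose theta := Num.max 0 ((p - a + 1) / (k - a)).
have t0 : 0 <= theta by rewrite le_max lexx.
have bt : p - a + 1 <= (k - a) * theta.
  move: ak; rewrite le_eqVlt => /predU1P[->|ak]; first by rewrite subrr mul0r; lra.
  have ka : 0 < k - a by lra.
  by rewrite mulrC -ler_pdivrMr // le_max lexx orbT.
have t1 : theta <= 1.
  rewrite /theta ge_max ler01 /=.
  move: ak; rewrite le_eqVlt => /predU1P[->|ak].
    by rewrite subrr invr0 mulr0 ler01.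
  by rewrite ler_pdivrMr; lra.
have at_ : a * theta <= q.
  rewrite /theta /Num.max; case: ifP => _; last by rewrite mulr0.
  move: ak; rewrite le_eqVlt => /predU1P[->|ak].
    by rewrite subrr invr0 !mulr0.
  by rewrite mulrA ler_pdivrMr; lra.
pose w i j := if c i && c j then 1 else if c i || c j then theta else 0.
apply: (le_trans (@prod_min1_le_weighted _ _ U x w x0 _ _)).
- by move=> i j; rewrite /w andbC orbC.
- by move=> i j; rewrite /w; case: ifP => _; [|case: ifP => _]; rewrite ?ler01 ?lexx ?t0.
have deg i : i \in U -> \sum_(j in U :\ i) w i j =
    \sum_(j in U) w i j - w i i.
  by move=> iU; rewrite (big_setD1 i iU) /= addrC addrK.
have cardA (z : R) : \sum_(j in U | c j) z = a * z.
  rewrite (eq_bigl (mem [set i in U | c i]%SET)); last by move=> i; rewrite !inE.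
  by rewrite sumr_const mulr_natl.
have cardB (z : R) : \sum_(j in U | ~~ c j) z = (k - a) * z.
  have : \sum_(j in U) z = k * z by rewrite sumr_const mulr_natl.
  by rewrite (bigID c) /= cardA => h; rewrite mulrBl -h addrC addrK.
apply: ler_prod => i iU; rewrite powR_ge0 /= /two_powers deg // (bigID c) /=.
have xi := x0 _ iU.
rewrite -/(c i); case: ifPn => [ci|/negPf ci].
  rewrite (eq_bigr (fun=> 1)); last by move=> j /andP[_ cj]; rewrite /w ci cj.
  rewrite [X in _ + X - _](eq_bigr (fun=> theta)); last first.
    by move=> j /andP[_ /negPf cj]; rewrite /w ci cj.
  rewrite cardA cardB /w ci /=.
  by apply: ger_powR; [rewrite xi|lra].
rewrite (eq_bigr (fun=> theta)); last first.
  by move=> j /andP[_ cj]; rewrite /w ci cj.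
rewrite [X in _ + X - _](eq_bigr (fun=> 0)); last first.
  by move=> j /andP[_ /negPf cj]; rewrite /w ci cj.
rewrite cardA cardB /w ci /=.
by apply: ler_powR; [by rewrite ltW // ltNge -/(c i) ci | lra].
Qed.

(** With [p = r + e] and [q = r - e] the inequality becomes
    [k e <= a ^ 2 - (2 r + 1) a + k r], where [k r >= (m + 2) r]. The parabola has
    its vertex at [r + 1 / 2], and the integer nearest to it is [m + 1]: the value
    there is at least [m (m + 1 - r)], whence the choice of [e]. *)
Lemma critical_exponents (R : realType) (r : R) (m k : nat) :
  (0 < m)%N -> m%:R < r < m.+1%:R -> (m.+2 <= k)%N ->
  exists p q : R, [/\ r < p, 0 < q < r & forall a : nat,
    a%:R * (p - a%:R + 1) <= (k%:R - a%:R) * q].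
Proof.
move=> m0 /andP[mr rm] mk; rewrite -natr1 in rm.
have m1 : 1 <= (m%:R : R) by rewrite ler1n.
have kR : (m%:R : R) + 2 <= k%:R by rewrite -natrD ler_nat addn2.
set M : R := m%:R in mr rm m1 kR *; set K : R := k%:R in kR *.
pose e := M * (M + 1 - r) / K.
have K0 : 0 < K by lra.
have e0 : 0 < e by rewrite divr_gt0 // mulr_gt0; lra.
have Ke : K * e = M * (M + 1 - r) by rewrite /e mulrCA mulfV ?mulr1 ?gt_eqF.
have er : e < r.
  rewrite ltr_pdivrMr //; nra.
exists (r + e), (r - e); split; [lra|lra|] => a.
set A : R := a%:R.
(* With [t = a - m - 1] the factor is [t (t + c)] where [|c| < 1], and [t] is an
   integer: hence [|t| <= t ^ 2]. *)
have : 0 <= (A - M - 1) * (A - M - 1 + 2 * (M - r) + 1).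
  case: (ltngtP a m.+1) => [am|am|am].
  - have : A + 1 <= M + 1 by rewrite !natr1 ler_nat ltnS.
    by rewrite -natr1 => h; nra.
  - have : M + 2 <= A by rewrite -natrD ler_nat addn2.
    by move=> h; nra.
  - have -> : A = M + 1 by rewrite /A am -natr1.
    by nra.
have : (K - M - 2) * r >= 0 by nra.
nra.
Qed.

(** * Expectations of products of independent variables *)

Lemma measurable_rv_preimage (R : realType) (d : measure_display)
    (T : measurableType d) (P : probability T R) (X : {RV P >-> R}) (B : set R) :
  measurable B -> measurable (X @^-1` B).
Proof.
by move=> mB; rewrite -[X in measurable X]setTI; exact: measurable_funPT.
Qed.

Lemma measurable_rv_indic (R : realType) (d : measure_display)
    (T : measurableType d) (P : probability T R) (X : {RV P >-> R}) (B : set R) :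
  measurable B -> measurable_fun setT (fun w => \1_B (X w) : R).
Proof.
move=> mB; rewrite (_ : (fun w => _) = \1_(X @^-1` B)).
  exact/measurable_indic/measurable_rv_preimage.
by apply/funext => w; rewrite !indicE.
Qed.

Lemma measurable_fun_prod_in (R : realType) (d : measure_display)
    (T : measurableType d) (I : finType) (S : {set I}) (f : I -> T -> R) :
  (forall i, measurable_fun setT (f i)) ->
  measurable_fun setT (fun w => \prod_(i in S) f i w).
Proof.
move=> mf; rewrite (_ : (fun w => _) = (fun w => \prod_(i <- enum S) f i w)).
  exact: measurable_prod.
by apply/funext => w; rewrite big_enum.
Qed.

(** Indexing by a finite type lets the sum be distributed over a product by
    [big_distr_big_dep]. *)
Lemma fimfun_sum (T : Type) (R : nzRingType) (f : {fimfun T >-> R}) (x : T) :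
  f x = \sum_(y : fset_set (range f)) val y * \1_(f @^-1` [set val y]) x.
Proof.
have fx : f x \in fset_set (range f).
  by rewrite in_fset_set //; apply/mem_set; exists x.
rewrite (bigD1 [` fx]%fset) //= [X in _ + X]big1 ?addr0.
  by rewrite indicE mem_set // mulr1.
move=> y yx; rewrite indicE memNset ?mulr0 //= => fxy.
by move/eqP: yx; apply; apply: val_inj.
Qed.

Section IndependentProducts.
Context (R : realType) (d0 : measure_display) (T0 : measurableType d0)
  (Q : probability T0 R) (H : {RV Q >-> R})
  (d : measure_display) (T : measurableType d) (P : probability T R)
  (n : nat) (W : 'I_n -> {RV P >-> R}).
Context (hW : iid_copies H W).

Lemma iid_prob (B : set R) i : measurable B ->
  P (W i @^-1` B) = (fine (Q (H @^-1` B)))%:E.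
Proof.
move=> mB; have := hW.2 i B mB; rewrite /distribution /pushforward /= => ->.
by rewrite fineK // fin_num_measure //; exact: measurable_rv_preimage.
Qed.

Lemma iid_prob_all (U : {set 'I_n}) (B : 'I_n -> set R) :
  (forall i, measurable (B i)) ->
  P [set w | forall i, i \in U -> B i (W i w)] =
  (\prod_(i in U) fine (Q (H @^-1` B i)))%:E.
Proof.
move=> mB; rewrite (hW.1 U B mB) -prodEFin.
by apply: eq_bigr => i _; exact: iid_prob.
Qed.

Lemma measurable_rv_all (U : {set 'I_n}) (B : 'I_n -> set R) :
  (forall i, measurable (B i)) ->
  measurable [set w | forall i, i \in U -> B i (W i w)].
Proof.
move=> mB.
apply: (@fin_bigcap_measurable _ _ _ [set` U] (fun i => W i @^-1` B i)).
  exact: finite_finset.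
by move=> i _; exact: measurable_rv_preimage.
Qed.

(** For simple functions the product expands into a linear combination of
    indicators of the events that the product rule evaluates. *)
Lemma integral_prod_simple (U : {set 'I_n}) (f : {nnsfun R >-> R}) :
  (\int[P]_w (\prod_(i in U) f (W i w))%:E)%E =
  (fine (\int[Q]_w (f (H w))%:E)%E ^+ #|U|)%:E.
Proof.
pose s := fset_set (range f).
pose B (y : s) := f @^-1` [set val y].
have mB y : measurable (B y).
  by rewrite -[X in measurable X]setTI; exact: measurable_funPT.
pose q y := fine (Q (H @^-1` B y)).
have s0 (y : s) : 0 <= val y.
  have := fsvalP y; rewrite in_fset_set // => /set_mem[x _ xy].
  suff: 0 <= fsval y by [].
  by rewrite -xy; exact: fun_ge0.
have -> : (\int[Q]_w (f (H w))%:E)%E = (\sum_y val y * q y)%:E.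
  under eq_integral => w _ do rewrite fimfun_sum -sumEFin.
  rewrite ge0_integral_sum //; last 2 first.
  - move=> y; apply/measurable_EFinP; apply: measurable_funM => //.
    exact: measurable_rv_indic.
  - by move=> y w _; rewrite lee_fin mulr_ge0.
  rewrite -sumEFin; apply: eq_bigr => y _.
  under eq_integral => w _ do rewrite EFinM.
  rewrite ge0_integralZl_EFin //; last first.
    apply/measurable_EFinP.
    exact: measurable_rv_indic.
  rewrite EFinM; congr (_ * _)%E.
  have mHB : measurable (H @^-1` B y) by exact: measurable_rv_preimage.
  rewrite /q fineK ?fin_num_measure //.
  have := integral_indic Q measurableT mHB; rewrite setIT => <-.
  by apply: eq_integral => w _; rewrite !indicE.
have f0 : f 0 \in s by rewrite in_fset_set //; apply/mem_set; exists 0.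
pose j0 : s := [` f0]%fset.
pose E (phi : {ffun 'I_n -> s}) :=
  [set w | forall i, i \in U -> B (phi i) (W i w)].
have mE phi : measurable (E phi).
  exact: (@measurable_rv_all U (fun i => B (phi i)) (fun i => mB (phi i))).
rewrite /= -prodr_const (big_distr_big_dep j0) /=.
rewrite (_ : (fun w => _) = (fun w => \sum_(phi <- enum (pfamily j0 (mem U) (fun _ => xpredT)))
   ((\prod_(i in U) val (phi i))%:E * (\1_(E phi) w)%:E)%E)); last first.
  apply/funext => w.
  under eq_bigr do rewrite fimfun_sum.
  rewrite (big_distr_big_dep j0) -sumEFin big_enum /=; apply: eq_bigr => phi _.
  rewrite big_split EFinM /=; congr (_ * _%:E)%E.
  rewrite indicE; have [/set_mem wE|wE] := boolP (w \in E phi).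
    by rewrite big1 // => i iU; rewrite indicE mem_set //; exact: wE.
  have : ~ E phi w by move/negP: wE; apply: contra_not => /mem_set.
  move/existsNP => [i /not_implyP[iU Bi]].
  by rewrite (bigD1 i) //= indicE memNset ?mul0r.
rewrite ge0_integral_sum //; last 2 first.
- move=> phi; apply: emeasurable_funM => //.
  by apply/measurable_EFinP; exact: measurable_indic.
- by move=> phi w _; rewrite -EFinM lee_fin mulr_ge0 // prodr_ge0.
rewrite big_enum -sumEFin /=; apply: eq_bigr => phi _.
rewrite ge0_integralZl_EFin //; last 2 first.
- by apply/measurable_EFinP; exact: measurable_indic.
- by apply: prodr_ge0 => i _; exact: s0.
rewrite integral_indic // setIT.
rewrite big_split EFinM; congr (_ * _)%E.
exact: (iid_prob_all U (fun i => mB (phi i))).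
Qed.

(** The simple case, passed to the limit along increasing simple approximations
    of [f]. *)
Lemma integral_prod_le (U : {set 'I_n}) (f : R -> R) (c : R) :
  measurable_fun setT f -> (forall x, 0 <= f x) ->
  (\int[Q]_w (f (H w))%:E <= c%:E)%E ->
  (\int[P]_w (\prod_(i in U) f (W i w))%:E <= (c ^+ #|U|)%:E)%E.
Proof.
move=> mf f0 fc.
have mEf : measurable_fun setT (EFin \o f) by apply/measurable_EFinP.
pose h := nnsfun_approx measurableT mEf.
have hf x : (h N x)%:E @[N --> \oo] --> (f x)%:E.
  apply: (cvg_nnsfun_approx measurableT mEf) => //.
  by move=> y _; rewrite lee_fin.
have hfR x : h N x @[N --> \oo] --> f x by have /fine_cvg := hf x.
have nd x : {homo (fun N => h N x) : a b / (a <= b)%N >-> a <= b}.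
  by move=> a b ab; have /lefP := nd_nnsfun_approx measurableT mEf ab; exact.
have hle N x : h N x <= f x.
  rewrite -(cvg_lim (@Rhausdorff R) (hfR x)).
  by apply: nondecreasing_cvgn_le => //; apply/cvg_ex; exists (f x); exact: hfR.
have mhW N : measurable_fun setT
    (fun w => (\prod_(i in U) h N (W i w))%:E).
  apply/measurable_EFinP; apply: measurable_fun_prod_in => i.
  exact: measurableT_comp.
have -> : (\int[P]_w (\prod_(i in U) f (W i w))%:E)%E =
  (\int[P]_w limn (fun N => (\prod_(i in U) h N (W i w))%:E))%E.
  apply: eq_integral => w _; apply/esym/cvg_lim => //.
  apply: cvg_EFin; first by near=> N.
  have cvgp (s : seq 'I_n) : \prod_(i <- s) h N (W i w) @[N --> \oo] -->
      \prod_(i <- s) f (W i w).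
    elim: s => [|i s IH].
      rewrite big_nil (_ : (fun N => _) = (fun=> 1)); first exact: cvg_cst.
      by apply/funext => N; rewrite big_nil.
    rewrite big_cons (_ : (fun N => _) = (fun N => h N (W i w) *
      \prod_(j <- s) h N (W j w))); first exact: cvgM.
    by apply/funext => N; rewrite big_cons.
  rewrite -big_enum (_ : _ \o _ = (fun N => \prod_(i <- enum U) h N (W i w))).
    exact: cvgp.
  by apply/funext => N; rewrite big_enum.
rewrite monotone_convergence //; last 2 first.
- by move=> N w _; rewrite lee_fin prodr_ge0.
- move=> w _ a b ab; rewrite lee_fin; apply: ler_prod => i iU.
  by rewrite fun_ge0 nd.
apply: lime_le.
  apply: ereal_nondecreasing_is_cvgn => a b ab; apply: ge0_le_integral => //.
  - by move=> w _; rewrite lee_fin prodr_ge0.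
  - move=> w _; rewrite lee_fin; apply: ler_prod => i iU.
    by rewrite fun_ge0 nd.
near=> N; rewrite integral_prod_simple lee_fin.
have hc : (\int[Q]_w (h N (H w))%:E <= c%:E)%E.
  apply: le_trans fc; apply: ge0_le_integral => //.
  - by move=> w _; rewrite lee_fin.
  - by apply/measurable_EFinP; apply: measurableT_comp.
  - by apply/measurable_EFinP; apply: measurableT_comp.
  - by move=> w _; rewrite lee_fin.
have h0 : (0 <= \int[Q]_w (h N (H w))%:E)%E.
  by apply: integral_ge0 => w _; rewrite lee_fin.
apply: lerXn2r; rewrite ?nnegrE.
- exact: fine_ge0.
- by rewrite -lee_fin (le_trans h0).
by rewrite -lee_fin fineK // ge0_fin_numE // (le_lt_trans hc) ?ltry.
Unshelve. all: by end_near.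
Qed.
End IndependentProducts.

(** * Truncated moments under a doubling condition on the tail *)

(** Ratio of the geometric series behind the two moment bounds. *)
Lemma powR2_lt1 (R : realType) (x y : R) : x < y -> 2 `^ (x - y) < 1 :> R.
Proof.
move=> xy; rewrite /powR pnatr_eq0 /= -[ltRHS]expR0 ltr_expR.
by rewrite pmulr_llt0 ?ln_gt0 ?ltr1n //; lra.
Qed.

Section TailMoments.
Context (R : realType) (d0 : measure_display) (T0 : measurableType d0)
  (Q : probability T0 R) (H : {RV Q >-> R}).
Context (hH : forall w, 1 <= H w).

Definition tail (h : R) : R := fine (ccdf H h).

Lemma measurable_gt_le (a b : R) : measurable [set w | a < H w <= b].
Proof.
have -> : [set w | a < H w <= b] = H @^-1` `]a, b]%classic.
  by apply/seteqP; split => w /=; rewrite in_itv.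
exact: measurable_rv_preimage.
Qed.

Lemma measurable_gt (a : R) : measurable [set w | a < H w].
Proof.
have -> : [set w | a < H w] = H @^-1` `]a, +oo[%classic.
  by apply/seteqP; split => w /=; rewrite in_itv /= andbT.
exact: measurable_rv_preimage.
Qed.

Lemma measurable_le (b : R) : measurable [set w | H w <= b].
Proof.
have -> : [set w | H w <= b] = H @^-1` `]-oo, b]%classic.
  by apply/seteqP; split => w /=; rewrite in_itv /=.
exact: measurable_rv_preimage.
Qed.

Lemma tailE (a : R) : Q [set w | a < H w] = (tail a)%:E.
Proof.
rewrite /tail /ccdf fineK; last by rewrite fin_num_measure.
rewrite /distribution /pushforward; congr (Q _).
by apply/seteqP; split => w /=; rewrite in_itv /= andbT.
Qed.

Lemma tail_ge0 (a : R) : 0 <= tail a.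
Proof. by rewrite -lee_fin -tailE measure_ge0. Qed.

Lemma tail_nincr (a b : R) : a <= b -> tail b <= tail a.
Proof.
move=> ab; rewrite -lee_fin -!tailE; apply: le_measure.
- exact/mem_set/measurable_gt.
- exact/mem_set/measurable_gt.
- by move=> w /=; exact: le_lt_trans.
Qed.

Lemma measurable_powH (q : R) (D : set T0) :
  measurable_fun D (fun w => (H w `^ q)%:E).
Proof.
apply: measurable_funTS; apply/measurable_EFinP.
exact: (measurableT_comp (measurable_powR q)).
Qed.

Lemma powH_ge0 (q : R) w : (0 <= (H w `^ q)%:E)%E.
Proof. by rewrite lee_fin powR_ge0. Qed.

Lemma H_ge0 w : 0 <= H w.
Proof. exact: le_trans ler01 (hH w). Qed.

Lemma integral_powH_le (q b : R) (D : set T0) : 0 <= q -> measurable D ->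
  (forall w, D w -> H w <= b) ->
  (\int[Q]_(w in D) (H w `^ q)%:E <= (b `^ q)%:E * Q D)%E.
Proof.
move=> q0 mD Db; rewrite -integral_cst //; apply: ge0_le_integral => //.
- by move=> w _; exact: powH_ge0.
- exact: measurable_powH.
- move=> w Dw; rewrite lee_fin ge0_ler_powR // ?nnegrE ?H_ge0 ?Db //.
  exact: le_trans (H_ge0 w) (Db w Dw).
Qed.

Lemma integral_powH_band (q a b : R) : 0 <= q ->
  (\int[Q]_(w in [set w | (a < H w <= b)%R]) (H w `^ q)%:E <=
   (b `^ q * tail a)%:E)%E.
Proof.
move=> q0; apply: le_trans (integral_powH_le (b := b) q0 _ _) _.
- exact: measurable_gt_le.
- by move=> w /= /andP[_]; exact.
rewrite EFinM -tailE; apply: lee_wpmul2l; first by rewrite lee_fin powR_ge0.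
apply: le_measure.
- exact/mem_set/measurable_gt_le.
- exact/mem_set/measurable_gt.
by move=> w /= /andP[].
Qed.

(** Over [s < H <= 2 ^ N s], peel off the band [s < H <= 2 s], which contributes
    at most [(2 s) ^ q F s]; what remains is the same quantity for [2 s] and
    [N - 1]. Going from [s] to [2 s] multiplies [s ^ q F s] by at most
    [c = 2 ^ (q - rho) < 1], so the constant solving [2 ^ q + C c = C] is
    preserved, uniformly in [N]. *)
Lemma upper_moment_doubling (q rho x0 : R) : 0 <= q -> q < rho -> 0 < x0 ->
  (forall x, x0 <= x -> tail (2 * x) <= 2 `^ (- rho) * tail x) ->
  exists2 C : R, 0 <= C & forall s, x0 <= s ->
    (\int[Q]_(w in [set w | (s < H w)%R]) (H w `^ q)%:E <=
     (C * (s `^ q * tail s))%:E)%E.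
Proof.
move=> q0 qr x00 dec.
have c1 := powR2_lt1 qr; set c := 2 `^ (q - rho) in c1.
have c0 : 0 <= c by exact: powR_ge0.
pose C := 2 `^ q / (1 - c).
have C0 : 0 <= C by rewrite divr_ge0 ?powR_ge0 //; lra.
have CE : 2 `^ q + C * c = C.
  by rewrite /C; field; rewrite subr_eq0 gt_eqF.
exists C => // s x0s.
pose D N s := [set w | s < H w <= 2 ^+ N * s].
have step N : forall s, x0 <= s ->
    (\int[Q]_(w in D N s) (H w `^ q)%:E <= (C * (s `^ q * tail s))%:E)%E.
  elim: N => [|N IH] {}s {}x0s.
    have -> : D 0%N s = set0.
      apply/seteqP; split => w //; rewrite /D /= expr0 mul1r.
      by move=> /andP[h1 h2]; have := lt_le_trans h1 h2; rewrite ltxx.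
    by rewrite integral_set0 lee_fin; apply: mulr_ge0 => //; apply: mulr_ge0; rewrite ?powR_ge0 ?tail_ge0.
  have s0 : 0 < s by exact: lt_le_trans x0s.
  have s2 : s <= 2 * s by lra.
  have N2 : 1 <= 2 ^+ N :> R by apply: exprn_ege1; lra.
  have -> : D N.+1 s = [set w | s < H w <= 2 * s] `|` D N (2 * s).
    apply/seteqP; split => w; rewrite /D /= exprSr -mulrA.
      move=> /andP[-> ->] /=; rewrite andbT.
      by case: (leP (H w) (2 * s)); [left|right].
    move=> [/andP[-> h]|/andP[h ->]] /=; last by rewrite (le_lt_trans s2 h).
    by apply: (le_trans h); rewrite ler_peMl //; lra.
  rewrite ge0_integral_setU //; first last.
  - apply/disj_setPS => w [/= /andP[_ h1] /andP[h2 _]].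
    by have := le_lt_trans h1 h2; rewrite ltxx.
  - by move=> w _; exact: powH_ge0.
  - exact: measurable_powH.
  - exact: measurable_gt_le.
  - exact: measurable_gt_le.
  apply: le_trans (leeD (integral_powH_band s (2 * s) q0) (IH (2 * s) _)) _.
    exact: le_trans s2.
  rewrite -EFinD lee_fin (powRM _ _ (ltW s0)) //.
  have cE : c = 2 `^ q * 2 `^ (- rho).
    by rewrite /c powRD // pnatr_eq0 implybT.
  have -> : C * (s `^ q * tail s) =
      2 `^ q * s `^ q * tail s + C * (2 `^ q * s `^ q * (2 `^ (- rho) * tail s)).
    by rewrite -{1}CE cE; ring.
  rewrite lerD2l; apply: ler_wpM2l => //; apply: ler_wpM2l; last exact: dec.
  by rewrite mulr_ge0 ?powR_ge0.
have -> : [set w | s < H w] = \bigcup_N D N s.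
  have s0 : 0 < s by exact: lt_le_trans x0s.
  apply/seteqP; split => w /=; last by move=> [N _ /andP[]].
  move=> sH; exists (Num.truncn (H w / s)).+1 => //=; rewrite /D /= sH /=.
  rewrite -ler_pdivrMr // ltW // (lt_le_trans (truncnS_gt _)) //.
  by rewrite -natrX ler_nat ltnW // ltn_expl.
have s0 : 0 < s by exact: lt_le_trans x0s.
have cv : (\int[Q]_(w in D N s) (H w `^ q)%:E)%E @[N --> \oo] -->
    (\int[Q]_(w in \bigcup_N D N s) (H w `^ q)%:E)%E.
  apply: ge0_nondecreasing_set_cvg_integral.
  - move=> a b ab; apply/subsetPset => w; rewrite /D /= => /andP[-> h] /=.
    apply: (le_trans h); apply: ler_wpM2r; first exact: ltW.
    by apply: ler_weXn2l => //; lra.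
  - by move=> i; exact: measurable_gt_le.
  - by move=> i; exact: measurable_powH.
  - by move=> i w _; exact: powH_ge0.
rewrite -(cvg_lim (@ereal_hausdorff R) cv); apply: lime_le.
  by apply/cvg_ex; eexists; exact: cv.
by apply: nearW => N; exact: step.
Qed.

(** Halving [s] down to [[x0, 2 x0]] peels off the bands [u < H <= 2 u]. Going
    from [2 u] to [u] multiplies [s ^ p F s] by at most [2 ^ (rho - p) < 1],
    which absorbs the bands; on [[x0, 2 x0]] the bound holds because [F] is
    bounded away from [0] there, which is the role of the term [C1]. *)
Lemma lower_moment_doubling (p rho x0 : R) : 0 <= p -> rho < p -> 0 < x0 ->
  (forall x, 0 < tail x) ->
  (forall x, x0 <= x -> tail x <= 2 `^ rho * tail (2 * x)) ->
  exists2 C : R, 0 <= C & forall s, x0 <= s ->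
    (\int[Q]_(w in [set w | (H w <= s)%R]) (H w `^ p)%:E <=
     (C * (s `^ p * tail s))%:E)%E.
Proof.
move=> p0 rp x00 t0 dec.
have c1 := powR2_lt1 rp; set c := 2 `^ (rho - p) in c1.
have c0 : 0 <= c by exact: powR_ge0.
pose C1 := (tail (2 * x0))^-1.
have C10 : 0 <= C1 by rewrite invr_ge0 ltW.
pose C2 := 2 `^ rho / (1 - c).
have C20 : 0 <= C2 by rewrite divr_ge0 ?powR_ge0 //; lra.
pose C := C1 + C2.
have cE : c * 2 `^ p = 2 `^ rho.
  by rewrite /c -powRD ?pnatr_eq0 ?implybT // subrK.
have CE : C * c + 2 `^ rho <= C.
  have : C2 * (1 - c) = 2 `^ rho by rewrite divfK // subr_eq0 gt_eqF.
  by rewrite /C; nra.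
exists C; first exact: addr_ge0.
suff step N : forall s, x0 <= s -> s <= 2 ^+ N * (2 * x0) ->
    (\int[Q]_(w in [set w | (H w <= s)%R]) (H w `^ p)%:E <=
     (C * (s `^ p * tail s))%:E)%E.
  move=> s x0s; apply: (step (Num.truncn (s / (2 * x0))).+1) => //.
  rewrite -ler_pdivrMr ?mulr_gt0 // ltW // (lt_le_trans (truncnS_gt _)) //.
  by rewrite -natrX ler_nat ltnW // ltn_expl.
have base s : x0 <= s -> s <= 2 * x0 ->
    (\int[Q]_(w in [set w | (H w <= s)%R]) (H w `^ p)%:E <=
     (C * (s `^ p * tail s))%:E)%E.
  move=> x0s s2; apply: le_trans (integral_powH_le (b := s) p0 _ _) _.
  - exact: measurable_le.
  - by move=> w /=; exact.
  apply: (@le_trans _ _ (s `^ p)%:E).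
    rewrite -[leRHS]mule1; apply: lee_wpmul2l; first by rewrite lee_fin powR_ge0.
    exact: probability_le1 (measurable_le _).
  rewrite lee_fin mulrCA ler_peMr ?powR_ge0 //.
  have : 1 <= C1 * tail s.
    by rewrite mulrC ler_pdivlMr // mul1r tail_nincr.
  have := tail_ge0 s.
  by rewrite /C; nra.
elim: N => [|N IH] s x0s; first by rewrite expr0 mul1r; exact: base.
move=> sN; case: (leP s (2 * x0)) => s2; first exact: base.
have [u us] : exists u, s = 2 * u by exists (s / 2); rewrite mulrC divfK ?pnatr_eq0.
have x0u : x0 <= u by lra.
have uN : u <= 2 ^+ N * (2 * x0).
  by move: sN; rewrite us exprS -mulrA ler_pM2l.
have u0 : 0 < u by exact: lt_le_trans x0u.
rewrite us.
have -> : [set w | H w <= 2 * u] = [set w | H w <= u] `|` [set w | u < H w <= 2 * u].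
  apply/seteqP; split => w /=.
    by move=> h; case: (leP (H w) u); [left|right].
  by move=> [h|/andP[]//]; lra.
rewrite ge0_integral_setU //; first last.
- apply/disj_setPS => w [/= h1 /andP[h2 _]].
  by have := le_lt_trans h1 h2; rewrite ltxx.
- by move=> w _; exact: powH_ge0.
- exact: measurable_powH.
- exact: measurable_gt_le.
- exact: measurable_le.
apply: le_trans (leeD (IH u x0u uN) (integral_powH_band u (2 * u) p0)) _.
rewrite -EFinD lee_fin (powRM _ _ (ltW u0)) //.
have := dec _ x0u.
have U0 : 0 <= u `^ p by exact: powR_ge0.
have P0 : 0 <= 2 `^ p :> R by exact: powR_ge0.
have T0' := tail_ge0 (2 * u).
move=> h.
have -> : C * (u `^ p * tail u) + 2 `^ p * u `^ p * tail u =
  u `^ p * ((C + 2 `^ p) * tail u) by ring.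
rewrite [leRHS](_ : _ = u `^ p * (C * 2 `^ p * tail (2 * u))); last by ring.
apply: ler_wpM2l => //.
have CP : 0 <= C + 2 `^ p by apply: addr_ge0 => //; exact: addr_ge0.
apply: le_trans (ler_wpM2l CP h) _.
rewrite mulrA; apply: ler_wpM2r => //.
rewrite -cE [leLHS](_ : _ = 2 `^ p * (C * c + c * 2 `^ p)); last by ring.
by rewrite cE [leRHS]mulrC; apply: ler_wpM2l.
Qed.
End TailMoments.

(** * Truncated moments of a regularly varying tail *)

Lemma measurable_two_powers (R : realType) (p q : R) :
  measurable_fun setT (two_powers p q).
Proof.
apply: measurable_fun_ifT; [exact: measurable_fun_ler| |];
  exact: measurable_powR.
Qed.

Lemma slowly_varying_bounds (R : realType) (l : R -> R) (lam a b : R) :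
  (forall x, 1 <= x -> 0 < l x) -> slowly_varying l -> 0 < lam ->
  a < 1 -> 1 < b ->
  exists2 x0 : R, 1 <= x0 &
    forall x, x0 <= x -> a * l x <= l (lam * x) <= b * l x.
Proof.
move=> l0 hl lam0 a1 b1.
pose e := Num.min (1 - a) (b - 1).
have e0 : 0 < e by rewrite lt_min !subr_gt0 a1.
have /cvgrPdist_le /(_ e e0) [M [Mr HM]] := hl lam lam0.
exists (Num.max 1 (M + 1)); first by rewrite le_max lexx.
move=> x; rewrite ge_max => /andP[x1 xM].
have lx := l0 _ x1.
have /HM : M < x by lra.
rewrite distrC ler_distl => /andP[h1 h2].
have ea : e <= 1 - a by rewrite ge_min lexx.
have eb : e <= b - 1 by rewrite ge_min lexx orbT.
apply/andP; split.
  by rewrite -ler_pdivlMr //; lra.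
by rewrite -ler_pdivrMr //; lra.
Qed.

Section RegularlyVaryingTail.
Context (R : realType) (d0 : measure_display) (T0 : measurableType d0)
  (Q : probability T0 R) (H : {RV Q >-> R}) (alpha : R) (l : R -> R).
Context (hl_pos : forall x, 1 <= x -> 0 < l x) (hl : slowly_varying l)
  (hH : forall w, 1 <= H w)
  (htail : forall h, 1 <= h -> ccdf H h = (h `^ (1 - alpha) * l h)%:E).

Lemma tail_regular h : 1 <= h -> tail H h = h `^ (1 - alpha) * l h.
Proof. by move=> h1; rewrite /tail htail. Qed.

Lemma tail_gt0 h : 0 < tail H h.
Proof.
have pos x : 1 <= x -> 0 < tail H x.
  by move=> x1; rewrite tail_regular // mulr_gt0 ?hl_pos // powR_gt0 // (lt_le_trans ltr01).
case: (leP 1 h) => [|h1]; first exact: pos.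
by apply: lt_le_trans (tail_nincr H (ltW h1)); exact: pos.
Qed.

(** By regular variation [F (2 x) / F x] tends to [2 ^ (1 - alpha)], which lies
    strictly between [2 ^ (- rho2)] and [2 ^ (- rho1)]. *)
Lemma tail_doubling (rho1 rho2 : R) : rho1 < alpha - 1 < rho2 ->
  exists2 x0 : R, 1 <= x0 & forall x, x0 <= x ->
    tail H (2 * x) <= 2 `^ (- rho1) * tail H x /\
    tail H x <= 2 `^ rho2 * tail H (2 * x).
Proof.
move=> /andP[r1 r2].
have a1 := powR2_lt1 r2.
have b1 : 1 < 2 `^ (alpha - 1 - rho1) :> R.
  have := powR2_lt1 r1; rewrite -opprB powRN invf_lt1 // powR_gt0 //.
have [x0 x01 Hx] := slowly_varying_bounds hl_pos hl (ltr0n R 2) a1 b1.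
exists x0 => // x x0x.
have x1 : 1 <= x by exact: le_trans x0x.
have /andP[h1 h2] := Hx x x0x.
rewrite !tail_regular //; last by lra.
rewrite powRM //; last by lra.
have X0 : 0 <= x `^ (1 - alpha) by exact: powR_ge0.
have n2 : 2 != 0 :> R by rewrite pnatr_eq0.
split.
  have -> : 2 `^ (- rho1) * (x `^ (1 - alpha) * l x) =
      2 `^ (1 - alpha) * x `^ (1 - alpha) * (2 `^ (alpha - 1 - rho1) * l x).
    have -> : 2 `^ (- rho1) = 2 `^ (1 - alpha) * 2 `^ (alpha - 1 - rho1) :> R.
      by rewrite -powRD ?n2 ?implybT //; congr (_ `^ _); ring.
    by ring.
  by apply: ler_wpM2l => //; rewrite mulr_ge0 ?powR_ge0.
have -> : 2 `^ rho2 * (2 `^ (1 - alpha) * x `^ (1 - alpha) * l (2 * x)) =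
    x `^ (1 - alpha) * (2 `^ (rho2 - (alpha - 1)) * l (2 * x)).
  have -> : 2 `^ (rho2 - (alpha - 1)) = 2 `^ rho2 * 2 `^ (1 - alpha) :> R.
    by rewrite -powRD ?n2 ?implybT //; congr (_ `^ _); ring.
  by ring.
apply: ler_wpM2l => //.
have -> : l x = 2 `^ (rho2 - (alpha - 1)) * (2 `^ (alpha - 1 - rho2) * l x).
  rewrite mulrA -powRD ?n2 ?implybT // (_ : _ + _ = 0); last by ring.
  by rewrite powRr0 mul1r.
by apply: ler_wpM2l => //; exact: powR_ge0.
Qed.

Lemma upper_moment_regular (q : R) : 0 <= q < alpha - 1 ->
  exists x0 C : R, [/\ 1 <= x0, 0 <= C & forall s, x0 <= s ->
    (\int[Q]_(w in [set w | (s < H w)%R]) (H w `^ q)%:E <=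
     (C * (s `^ q * tail H s))%:E)%E].
Proof.
move=> /andP[q0 qr].
have r1 : (q + (alpha - 1)) / 2 < alpha - 1 < alpha by lra.
have [x0 x01 Hx] := tail_doubling r1.
have qrho : q < (q + (alpha - 1)) / 2 by lra.
have [C C0 HC] := upper_moment_doubling hH q0 qrho (lt_le_trans ltr01 x01)
  (fun x hx => (Hx x hx).1).
by exists x0, C.
Qed.

Lemma lower_moment_regular (p : R) : 0 <= p -> alpha - 1 < p ->
  exists x0 C : R, [/\ 1 <= x0, 0 <= C & forall s, x0 <= s ->
    (\int[Q]_(w in [set w | (H w <= s)%R]) (H w `^ p)%:E <=
     (C * (s `^ p * tail H s))%:E)%E].
Proof.
move=> p0 pr.
have r1 : alpha - 2 < alpha - 1 < (p + (alpha - 1)) / 2 by lra.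
have [x0 x01 Hx] := tail_doubling r1.
have rhop : (p + (alpha - 1)) / 2 < p by lra.
have [C C0 HC] := lower_moment_doubling hH p0 rhop (lt_le_trans ltr01 x01)
  tail_gt0 (fun x hx => (Hx x hx).2).
by exists x0, C.
Qed.

(** The part [H <= x0] is bounded, and the part [H > x0] is an upper truncated
    moment. *)
Lemma moment_finite (q : R) : 0 <= q < alpha - 1 ->
  exists C : R, (\int[Q]_w (H w `^ q)%:E <= C%:E)%E.
Proof.
move=> hq; have [x0 [C [x01 C0 HC]]] := upper_moment_regular hq.
have /andP[q0 _] := hq.
exists (x0 `^ q + C * (x0 `^ q * tail H x0)).
have -> : [set: T0] = [set w | H w <= x0] `|` [set w | x0 < H w].
  by apply/seteqP; split => w // _ /=; case: (leP (H w) x0); [left|right].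
rewrite ge0_integral_setU //; first last.
- apply/disj_setPS => w [/= h1 h2].
  by have := le_lt_trans h1 h2; rewrite ltxx.
- by move=> w _; exact: powH_ge0.
- exact: measurable_powH.
- exact: measurable_gt.
- exact: measurable_le.
rewrite EFinD; apply: leeD; last exact: HC.
apply: le_trans (integral_powH_le (b := x0) hH q0 (measurable_le _ _) _) _.
  by [].
rewrite -[leRHS]mule1; apply: lee_wpmul2l; first by rewrite lee_fin powR_ge0.
exact: probability_le1 (measurable_le _ _).
Qed.

(** The content is that the expectation is finite: [fine] would send an infinite
    one to [0]. *)
Lemma expectation_ge1 : 2 < alpha -> 1 <= fine ('E_Q[H])%E.
Proof.
move=> a2.
have E : ('E_Q[H] = \int[Q]_w (H w `^ 1)%:E)%E.
  rewrite unlock; apply: eq_integral => w _; rewrite powRr1 //.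
  exact: le_trans ler01 (hH w).
have [C HC] : exists C : R, (\int[Q]_w (H w `^ 1)%:E <= C%:E)%E.
  by apply: moment_finite; lra.
have h1 : (1 <= 'E_Q[H])%E.
  have -> : (1 = \int[Q]_w (cst 1 w))%E.
    by rewrite integral_cst // mul1e; exact/esym/probability_setT.
  rewrite E; apply: ge0_le_integral => //; first exact: measurable_powH.
  by move=> w _; rewrite powRr1 ?lee_fin //; exact: le_trans ler01 (hH w).
rewrite -lee_fin fineK // ge0_fin_numE ?(le_trans _ h1) //.
by rewrite E (le_lt_trans HC) // ltry.
Qed.

(** Each branch of [two_powers] lives where the matching truncated moment is
    dominated by the values of [H] of order [s]. *)
Lemma two_powers_moment (p q : R) : alpha - 1 < p -> 0 <= q < alpha - 1 ->
  exists x0 C : R, [/\ 1 <= x0, 0 <= C & forall s, x0 <= s ->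
    (\int[Q]_w (two_powers p q (H w / s))%:E <= (C * tail H s)%:E)%E].
Proof.
move=> pr hq; have p0 : 0 <= p by lra.
have [x0 [C [x01 C0 HC]]] := upper_moment_regular hq.
have [x0' [C' [x01' C0' HC']]] := lower_moment_regular p0 pr.
exists (Num.max x0 x0'), (C' + C); split.
- by rewrite le_max x01.
- exact: addr_ge0.
move=> s; rewrite ge_max => /andP[x0s x0s'].
have s0 : 0 < s by rewrite (lt_le_trans ltr01) // (le_trans x01).
have scale a w : (H w / s) `^ a = s `^ (- a) * H w `^ a.
  by rewrite powRM ?H_ge0 ?invr_ge0 ?ltW // mulrC -powR_inv1 ?ltW // -powRrM mulN1r.
have cancel a : s `^ (- a) * s `^ a = 1.
  by rewrite -powRD ?addNr ?powRr0 // (gt_eqF s0) implybT.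
have mtp : measurable_fun setT (fun w => (two_powers p q (H w / s))%:E).
  apply/measurable_EFinP; apply: (measurableT_comp (measurable_two_powers p q)).
  exact: measurable_funM.
have -> : [set: T0] = [set w | H w <= s] `|` [set w | s < H w].
  by apply/seteqP; split => w // _ /=; case: (leP (H w) s); [left|right].
rewrite ge0_integral_setU //; first last.
- apply/disj_setPS => w [/= h1 h2].
  by have := le_lt_trans h1 h2; rewrite ltxx.
- by move=> w _; rewrite lee_fin /two_powers; case: ifP; rewrite powR_ge0.
- exact: measurable_funTS.
- exact: measurable_gt.
- exact: measurable_le.
rewrite mulrDl EFinD; apply: leeD.
  rewrite (eq_integral (fun w => ((s `^ (- p))%:E * (H w `^ p)%:E)%E)); last first.
    move=> w /set_mem /= ws; rewrite /two_powers.
    by rewrite ler_pdivrMr // mul1r ws scale EFinM.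
  rewrite ge0_integralZl_EFin ?powR_ge0 //; last 3 first.
  - exact: measurable_le.
  - by move=> w _; exact: powH_ge0.
  - exact: measurable_powH.
  apply: le_trans (lee_wpmul2l _ (HC' s x0s')) _; first by rewrite lee_fin powR_ge0.
  by rewrite -EFinM lee_fin mulrCA [_ `^ _ * (_ * _)]mulrA cancel mul1r.
rewrite (eq_integral (fun w => ((s `^ (- q))%:E * (H w `^ q)%:E)%E)); last first.
  move=> w /set_mem /= ws; rewrite /two_powers.
  by rewrite ler_pdivrMr // mul1r leNgt ws /= scale EFinM.
rewrite ge0_integralZl_EFin ?powR_ge0 //; last 3 first.
- exact: measurable_gt.
- by move=> w _; exact: powH_ge0.
- exact: measurable_powH.
apply: le_trans (lee_wpmul2l _ (HC s x0s)) _; first by rewrite lee_fin powR_ge0.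
by rewrite -EFinM lee_fin mulrCA [_ `^ _ * (_ * _)]mulrA cancel mul1r.
Qed.
End RegularlyVaryingTail.

(** * The clique probability as an integral over the weights *)

Lemma card_first_nodes (n k : nat) : (k <= n)%N -> #|first_nodes n k| = k.
Proof.
move=> kn; rewrite /first_nodes cardsE -sum1_card.
rewrite (eq_bigl (fun i : 'I_n => (i < k)%N)) // -(big_ord_widen _ (fun=> 1%N)) //.
by rewrite sum1_card card_ord.
Qed.

(** The weights are only almost surely at least [1], so the normalized weights
    [x] are cut off at [1]: they become positive everywhere, and the integral
    does not change. *)
Section CliqueProbability.
Context (R : realType) (d0 : measure_display) (T0 : measurableType d0)
  (Q : probability T0 R) (H : {RV Q >-> R})
  (d : measure_display) (T : measurableType d) (P : probability T R)
  (n k : nat) (W : 'I_n -> {RV P >-> R}) (G : T -> rel 'I_n).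
Context (hH : forall w, 1 <= H w) (hG : chung_lu H W G)
  (mu1 : 1 <= fine 'E_Q[H]) (k0 : (0 < k)%N) (kn : (k <= n)%N).

Let U := first_nodes n k.
Let s := Num.sqrt (fine 'E_Q[H] * n%:R).
Let x (w : T) (i : 'I_n) : R := Num.max (W i w) 1 / s.

Lemma clique_eventE : clique_event G k = edges_present G (node_pairs U).
Proof.
apply/seteqP; split => w /= cl.
  move=> [i j]; rewrite inE /= => /and3P[iU jU ij]; apply: cl => //.
  by rewrite -(inj_eq val_inj) /= ltn_eqF.
move=> i j iU jU; rewrite -(inj_eq val_inj) /= neq_ltn => /orP[ij|ji].
  by apply: (cl (i, j)); rewrite inE /= iU jU.
by rewrite (cl_sym hG); apply: (cl (j, i)); rewrite inE /= iU jU.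
Qed.

Let mun0 : 0 < fine 'E_Q[H] * n%:R.
Proof.
by rewrite mulr_gt0 ?ltr0n ?(leq_trans k0) // (lt_le_trans ltr01).
Qed.

Let s0 : 0 < s. Proof. by rewrite sqrtr_gt0. Qed.

Let x_gt0 w i : 0 < x w i.
Proof. by rewrite divr_gt0 // lt_max ltr01 orbT. Qed.

Let measurable_x i : measurable_fun setT (x ^~ i).
Proof. by apply: measurable_funM => //; exact: measurable_maxr. Qed.

Let kernel w := \prod_(e in node_pairs U) Num.min (x w e.1 * x w e.2) 1.

Let kernel_ge0 w : 0 <= kernel w.
Proof.
by apply: prodr_ge0 => e _; rewrite le_min ler01 mulr_ge0 // ltW.
Qed.

Let measurable_kernel : measurable_fun setT kernel.
Proof.
apply: measurable_fun_prod_in => e.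
by apply: measurable_minr => //; exact: measurable_funM.
Qed.

Lemma prob_cliqueE : P (clique_event G k) = (\int[P]_w (kernel w)%:E)%E.
Proof.
rewrite clique_eventE -[edges_present _ _]setTI.
rewrite (cl_edges hG); last 2 first.
- by move=> e; rewrite inE => /and3P[].
- by rewrite -(setCK setT) setCT; apply: sigma_algebraC; exact: sigma_algebra0.
have hW := cl_weights hG.
apply: ae_eq_integral => //.
- apply/measurable_EFinP; apply: measurable_fun_prod_in => e.
  apply: measurable_minr => //; apply: measurable_funM => //.
  exact: measurable_funM.
- exact/measurable_EFinP.
pose B (_ : 'I_n) := `[1%R : R, +oo[%classic.
have mB i : measurable (B i) by exact: measurable_itv.
have P1 : P [set w | forall i, i \in [set: 'I_n]%SET -> B i (W i w)] = 1%E.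
  rewrite (iid_prob_all hW _ mB) big1 // => i _.
  rewrite (_ : H @^-1` _ = setT) ?probability_setT //.
  by apply/seteqP; split => w // _; rewrite /preimage /B /= in_itv /= hH.
exists (~` [set w | forall i, i \in [set: 'I_n]%SET -> B i (W i w)]); split.
- by apply: measurableC; exact: (measurable_rv_all W _ mB).
- have := probability_setC P (measurable_rv_all W [set: _]%SET mB).
  by rewrite P1 subee.
move=> w; apply: contra_not => /= W1 _; congr (_%:E); apply: eq_bigr => e _.
have W1' i : Num.max (W i w) 1 = W i w.
  by apply/max_idPl; have := W1 i; rewrite finset.in_setT /B /= in_itv /= andbT => ->.
rewrite /edge_prob /x !W1' mulf_div -expr2 sqr_sqrtr ?(ltW mun0) //.
Qed.

Lemma prob_clique_fin : P (clique_event G k) \is a fin_num.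
Proof.
apply: fin_num_measure; rewrite clique_eventE.
apply: (@fin_bigcap_measurable _ _ _ [set` node_pairs U]
  (fun e => [set w | G w e.1 e.2])); first exact: finite_finset.
by move=> e _; exact: (cl_meas hG).
Qed.

(** Restriction to the event that the [k] weights lie in [B], where every edge
    has conditional probability at least [c ^ 2]. *)
Lemma prob_clique_ge (c : R) (B : set R) : measurable B -> 0 <= c <= 1 ->
  (forall h, B h -> c * s <= h) ->
  (c ^+ k.-1 * fine (Q (H @^-1` B))) ^+ k <= fine (P (clique_event G k)).
Proof.
move=> mB /andP[c0 c1] Bc; have hW := cl_weights hG.
pose E := [set w | forall i, i \in U -> B (W i w)].
have mE : measurable E by exact: (measurable_rv_all W _ (fun=> mB)).
rewrite -lee_fin fineK ?prob_clique_fin // prob_cliqueE.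
have PE : P E = (fine (Q (H @^-1` B)) ^+ k)%:E.
  rewrite (iid_prob_all hW U (fun=> mB)) prodr_const.
  by rewrite card_first_nodes.
have cE : \prod_(e in node_pairs U) (c * c) = (c ^+ k.-1) ^+ k.
  rewrite (prod_node_pairs U (fun _ _ => c)).
  rewrite (eq_bigr (fun=> c ^+ k.-1)) ?prodr_const ?card_first_nodes //.
  move=> i iU; rewrite prodr_const; congr (_ ^+ _).
  by have := cardsD1 i U; rewrite iU card_first_nodes // => ->.
rewrite exprMn EFinM -PE -cE.
have -> : P E = (\int[P]_w (\1_E w)%:E)%E by rewrite integral_indic // setIT.
rewrite -ge0_integralZl_EFin //; last 2 first.
- by apply/measurable_EFinP; exact: measurable_indic.
- by apply: prodr_ge0 => e _; exact: mulr_ge0.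
apply: ge0_le_integral => //.
- move=> w _; rewrite -EFinM lee_fin mulr_ge0 //.
  by apply: prodr_ge0 => e _; exact: mulr_ge0.
- apply: emeasurable_funM => //.
  by apply/measurable_EFinP; exact: measurable_indic.
- exact/measurable_EFinP.
move=> w _; rewrite -EFinM lee_fin indicE.
have [/set_mem wE|_] := boolP (w \in E); last by rewrite mulr0.
rewrite mulr1; apply: ler_prod => e; rewrite inE => /and3P[e1 e2 _].
have xc i : i \in U -> c <= x w i.
  by move=> iU; rewrite ler_pdivlMr // le_max Bc //; exact: wE.
by rewrite mulr_ge0 //= le_min ler_pM ?xc //= mulr_ile1.
Qed.

(** Once the edge probabilities are dominated by a product of functions of one
    weight each, independence factors the integral. *)
Lemma prob_clique_le (g : R -> R) (c : R) : measurable_fun setT g ->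
  (forall y, 0 <= g y) ->
  (forall y : 'I_n -> R, (forall i, i \in U -> 0 < y i) ->
    \prod_(e in node_pairs U) Num.min (y e.1 * y e.2) 1 <=
    \prod_(i in U) g (y i)) ->
  (\int[Q]_w (g (H w / s))%:E <= c%:E)%E ->
  fine (P (clique_event G k)) <= c ^+ k.
Proof.
move=> mg g0 gle gc; have hW := cl_weights hG.
rewrite -lee_fin fineK ?prob_clique_fin // prob_cliqueE.
pose f h := g (Num.max h 1 / s).
have mf : measurable_fun setT f.
  apply: (measurableT_comp mg); apply: measurable_funM => //.
  exact: measurable_maxr.
apply: (@le_trans _ _ (\int[P]_w (\prod_(i in U) f (W i w))%:E)%E).
  apply: ge0_le_integral => //.
  - by move=> w _; rewrite lee_fin.
  - exact/measurable_EFinP.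
  - apply/measurable_EFinP; apply: measurable_fun_prod_in => i.
    exact: measurableT_comp.
  - by move=> w _; rewrite lee_fin; apply: gle => i _; exact: x_gt0.
have f0 h : 0 <= f h by exact: g0.
have /(integral_prod_le hW U mf f0) : (\int[Q]_w (f (H w))%:E <= c%:E)%E.
  rewrite (eq_integral (fun w => (g (H w / s))%:E)) // => w _.
  by rewrite /f; congr (g (_ / _))%:E; apply/max_idPl.
by rewrite card_first_nodes //; apply.
Qed.
End CliqueProbability.

(** * The two regimes *)

Lemma asymp_same_order_intro (R : realType) (f g : nat -> R) (n0 : nat)
    (C1 C2 : R) : 0 < C1 ->
  (forall n, (n0 < n)%N -> 0 <= g n /\ C1 * g n <= f n <= C2 * g n) ->
  asymp_same_order f g.
Proof.
move=> C10 H; exists n0, C1, (Num.max C2 (C1 + 1)); split => //.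
  by rewrite lt_max ltrDl ltr01 orbT.
move=> n /H[g0 /andP[-> h]] /=; apply: (le_trans h).
by apply: ler_wpM2r => //; rewrite le_max lexx.
Qed.

Lemma powR_natmul (R : realType) (x a : R) (k : nat) :
  x `^ (k%:R * a) = (x `^ a) ^+ k.
Proof. by rewrite mulrC powRrM powR_mulrn ?powR_ge0. Qed.

Lemma sqrt_powR (R : realType) (x a : R) : 0 <= x ->
  Num.sqrt x `^ a = x `^ (a / 2).
Proof. by move=> x0; rewrite -powR12_sqrt // -powRrM mulrC. Qed.

Lemma eventually_le_sqrt (R : realType) (c x : R) : 0 < c ->
  exists N : nat, forall n, (N < n)%N -> x <= Num.sqrt (c * n%:R).
Proof.
move=> c0; exists (Num.truncn (x ^+ 2 / c)) => n Nn.
have h : x ^+ 2 <= c * n%:R.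
  rewrite mulrC -ler_pdivrMr //.
  apply: le_trans (ltW (truncnS_gt _)) _.
  by rewrite ler_nat.
case: (ltP x 0) => [x0|x0]; first by rewrite ltW // (lt_le_trans x0) // sqrtr_ge0.
by rewrite -(ler_sqr x0) ?nnegrE ?sqrtr_ge0 // sqr_sqrtr // mulr_ge0 // ltW.
Qed.

Section TwoRegimes.
Context (R : realType) (alpha : R) (k : nat) (l : R -> R)
  (d0 : measure_display) (T0 : measurableType d0) (Q : probability T0 R)
  (H : {RV Q >-> R})
  (d : nat -> measure_display) (T : forall n, measurableType (d n))
  (P : forall n, probability (T n) R)
  (W : forall n, 'I_n -> {RV (P n) >-> R})
  (G : forall n, T n -> rel 'I_n).
Context (halpha : 2 < alpha) (hk : (2 <= k)%N)
    (hl_pos : forall x, 1 <= x -> 0 < l x) (hl : slowly_varying l)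
    (hH : forall w, 1 <= H w)
    (htail : forall h, 1 <= h -> ccdf H h = (h `^ (1 - alpha) * l h)%:E)
    (hG : forall n, (k <= n)%N -> chung_lu H (@W n) (@G n)).

Let mu : R := fine ('E_Q[H])%E.
Let mu1 : 1 <= mu. Proof. exact: expectation_ge1 hl_pos hl hH htail halpha. Qed.
Let mu0 : 0 < mu. Proof. exact: lt_le_trans ltr01 mu1. Qed.
Let s n : R := Num.sqrt (mu * n%:R).
Let k0 : (0 < k)%N. Proof. exact: leq_trans hk. Qed.

Let s_powR n (a : R) :
  s n `^ a = mu `^ (a / 2) * n%:R `^ (a / 2).
Proof. by rewrite sqrt_powR ?mulr_ge0 ?(ltW mu0) // powRM // ltW. Qed.

(** Both bounds are multiples of [s ^ (k (1 - k))]: the cheapest clique needs no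
    exceptional weight. *)
Lemma clique_asymp_k_lt_alpha : k%:R < alpha ->
  asymp_same_order (fun n => fine (P n (clique_event (@G n) k)))
       (fun n => n%:R `^ (k%:R / 2 * (1 - k%:R))).
Proof.
move=> ka.
have kq : 0 <= (k%:R - 1 : R) < alpha - 1.
  by rewrite subr_ge0 ler1n k0 ltrD2r.
have [C HC] := moment_finite hl_pos hl hH htail kq.
have C0 : 0 <= C.
  rewrite -lee_fin; apply: le_trans HC; apply: integral_ge0 => w _.
  exact: powH_ge0.
have [N1 HN1] := eventually_le_sqrt 1 mu0.
pose b : R := mu `^ (k%:R / 2 * (1 - k%:R)).
apply: (@asymp_same_order_intro _ _ _ (maxn k N1) b (C ^+ k * b)).
  by rewrite powR_gt0.
move=> n; rewrite gtn_max => /andP[kn Nn].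
split; first exact: powR_ge0.
have s1 : 1 <= s n by exact: HN1.
have s0 : 0 < s n by exact: lt_le_trans ltr01 s1.
have hGn := hG (ltnW kn).
have -> : b * n%:R `^ (k%:R / 2 * (1 - k%:R)) = (s n `^ (1 - k%:R)) ^+ k.
  by rewrite -powR_natmul s_powR /b; congr (_ `^ _ * _ `^ _); ring.
rewrite -mulrA.
have -> : b * n%:R `^ (k%:R / 2 * (1 - k%:R)) = (s n `^ (1 - k%:R)) ^+ k.
  by rewrite -powR_natmul s_powR /b; congr (_ `^ _ * _ `^ _); ring.
apply/andP; split.
  have := prob_clique_ge hH hGn mu1 k0 (ltnW kn)
    (c := (s n)^-1) (B := `[1, +oo[%classic).
  have -> : H @^-1` `[1, +oo[%classic = setT.
    by apply/seteqP; split => w // _; rewrite /preimage /= in_itv /= hH.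
  rewrite probability_setT /= mulr1 => h.
  apply: le_trans (h _ _ _).
  - rewrite -(powR_inv1 (ltW s0)) -(powR_natmul _ _ k.-1).
    suff -> : k.-1%:R * -1 = 1 - k%:R :> R by [].
    by rewrite -{2}(prednK k0) -natr1; ring.
  - exact: measurable_itv.
  - by rewrite invr_ge0 ltW //= invf_le1.
  - by move=> x; rewrite /= in_itv /= andbT mulVf ?gt_eqF.
rewrite -exprMn.
apply: (prob_clique_le hH hGn mu1 k0 (ltnW kn)
  (g := fun y => y `^ (k%:R - 1))).
- exact: measurable_powR.
- by move=> y; exact: powR_ge0.
- move=> y /prod_min1_le_complete.
  by rewrite card_first_nodes // ltnW.
rewrite -/mu -/(s n).
under eq_integral => w _.
  rewrite powRM ?H_ge0 ?invr_ge0 ?(ltW s0) // mulrC -(powR_inv1 (ltW s0)) -powRrM mulN1r opprB.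
  rewrite EFinM; over.
rewrite ge0_integralZl_EFin ?powR_ge0 //; last 2 first.
- by move=> w _; exact: powH_ge0.
- exact: measurable_powH.
by rewrite mulrC EFinM; apply: lee_wpmul2l; rewrite ?lee_fin ?powR_ge0.
Qed.

(** Both bounds are multiples of [F s ^ k]: a clique is as likely as [k] weights
    above [s]. The factor [sqrt mu] in [s = sqrt mu * sqrt n] is removed from the
    argument of [l] by slow variation. *)
Lemma clique_asymp_alpha_lt_k : alpha \isn't a Num.int -> alpha < k%:R ->
     asymp_same_order (fun n => fine (P n (clique_event (@G n) k)))
       (fun n => n%:R `^ (k%:R / 2 * (1 - alpha)) *
                 l (Num.sqrt n%:R) ^+ k).
Proof.
move=> halphaZ ak.
pose m := Num.truncn (alpha - 1).
have a1 : 0 <= alpha - 1 by have := halpha; lra.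
have /andP[ma am] := truncn_itv a1.
(* Integrality of [alpha] is excluded exactly here: [m] is the integral part of
   [alpha - 1]. *)
have m_lt : m%:R < alpha - 1.
  rewrite lt_neqAle ma andbT; apply: contra halphaZ => /eqP E.
  have -> : alpha = m.+1%:R by rewrite -natr1 E; ring.
  exact: natr_int.
have m0 : (0 < m)%N by rewrite truncn_gt0; have := halpha; lra.
have mk : (m.+2 <= k)%N.
  rewrite -(ltr_nat R); apply: lt_trans ak; rewrite -natr1; lra.
have m_itv : m%:R < alpha - 1 < m.+1%:R by rewrite m_lt.
have [p [q [rp /andP[q0 qr] pq]]] := critical_exponents m0 m_itv mk.
have hq : 0 <= q < alpha - 1 by rewrite ltW.
have [x0 [C [x01 C0 HC]]] := two_powers_moment hl_pos hl hH htail rp hq.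
have smu : 0 < Num.sqrt mu by rewrite sqrtr_gt0.
have half1 : (2^-1 : R) < 1 by lra.
have two1 : (1 : R) < 2 by lra.
have [x1 x11 Hl] := slowly_varying_bounds hl_pos hl smu half1 two1.
have [N1 HN1] := eventually_le_sqrt x0 mu0.
have [N2 HN2] := eventually_le_sqrt x1 (@ltr01 R).
pose b : R := mu `^ ((1 - alpha) / 2).
have b0 : 0 < b by rewrite powR_gt0.
apply: (@asymp_same_order_intro _ _ _ (maxn k (maxn N1 N2))
  ((b / 2) ^+ k) ((C * (b * 2)) ^+ k)).
  by rewrite exprn_gt0 // divr_gt0.
move=> n; rewrite !gtn_max => /and3P[kn Nn1 Nn2].
have x1n : x1 <= Num.sqrt n%:R by have := HN2 n Nn2; rewrite mul1r.
have n1 : 1 <= Num.sqrt n%:R :> R by exact: le_trans x1n.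
have x0s : x0 <= s n by exact: HN1.
have s1 : 1 <= s n by exact: le_trans x0s.
have s0 : 0 < s n by exact: lt_le_trans s1.
have ln0 : 0 < l (Num.sqrt n%:R) by exact: hl_pos.
have hGn := hG (ltnW kn).
set t := n%:R `^ ((1 - alpha) / 2).
have t0 : 0 <= t by exact: powR_ge0.
have -> : n%:R `^ (k%:R / 2 * (1 - alpha)) * l (Num.sqrt n%:R) ^+ k =
    (t * l (Num.sqrt n%:R)) ^+ k.
  by rewrite exprMn /t -powR_natmul; congr (_ `^ _ * _); ring.
have g0 : 0 <= t * l (Num.sqrt n%:R) by rewrite mulr_ge0 // ltW.
split; first exact: exprn_ge0.
have tE : tail H (s n) = b * t * l (Num.sqrt mu * Num.sqrt n%:R).
  rewrite (tail_regular htail) // s_powR -/b -/t; congr (_ * l _).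
  by rewrite /s sqrtrM // ltW.
have /andP[l1 l2] := Hl _ x1n.
have bt0 : 0 <= b * t by rewrite mulr_ge0 // ltW.
rewrite -!exprMn; apply/andP; split.
  have := prob_clique_ge hH hGn mu1 k0 (ltnW kn)
    (c := 1) (B := `]s n, +oo[%classic).
  have -> : H @^-1` `]s n, +oo[%classic = [set w | s n < H w].
    by apply/seteqP; split => w; rewrite /preimage /= in_itv /= andbT.
  rewrite tailE /= expr1n !mul1r tE => h.
  apply: le_trans (h _ _ _).
  - apply: lerXn2r; rewrite ?nnegrE.
    + by rewrite mulr_ge0 // divr_ge0 // ltW.
    + apply: mulr_ge0 => //; apply: le_trans _ l1.
      by rewrite mulr_ge0 ?invr_ge0 ?ltW.
    + have -> : b / 2 * (t * l (Num.sqrt n%:R)) =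
        b * t * (2^-1 * l (Num.sqrt n%:R)) by ring.
      exact: ler_wpM2l.
  - exact: measurable_itv.
  - by rewrite ler01 lexx.
  - by move=> x; rewrite /= in_itv /= andbT => /ltW.
apply: le_trans (_ : (C * tail H (s n)) ^+ k <= _).
  apply: (prob_clique_le hH hGn mu1 k0 (ltnW kn)
    (g := two_powers p q)).
  - exact: measurable_two_powers.
  - by move=> y; rewrite /two_powers; case: ifP; rewrite powR_ge0.
  - move=> y y0; apply: prod_min1_le_two_powers => //.
    + by rewrite card_first_nodes // ltnW.
    + exact: ltW.
    + by move=> a _; rewrite card_first_nodes // ltnW.
  exact: HC.
apply: lerXn2r; rewrite ?nnegrE.
- by rewrite mulr_ge0 // tail_ge0.
- by rewrite !mulr_ge0 // ltW.
rewrite -!mulrA; apply: ler_wpM2l => //.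
rewrite tE [leRHS](_ : _ = b * t * (2 * l (Num.sqrt n%:R))); last by ring.
exact: ler_wpM2l.
Qed.
End TwoRegimes.

Theorem theorem3p1 (R : realType) (alpha : R) (k : nat) (l : R -> R)
    (d0 : measure_display) (T0 : measurableType d0) (Q : probability T0 R)
    (H : {RV Q >-> R})
    (d : nat -> measure_display) (T : forall n, measurableType (d n))
    (P : forall n, probability (T n) R)
    (W : forall n, 'I_n -> {RV (P n) >-> R})
    (G : forall n, T n -> rel 'I_n)
    (halpha : 2 < alpha) (halphaZ : alpha \isn't a Num.int)
    (hk : (2 <= k)%N)
    (hl_pos : forall x, 1 <= x -> 0 < l x) (hl : slowly_varying l)
    (hH : forall w, 1 <= H w)
    (htail : forall h, 1 <= h -> ccdf H h = (h `^ (1 - alpha) * l h)%:E)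
    (hG : forall n, (k <= n)%N -> chung_lu H (W n) (G n)) :
  (k%:R < alpha ->
     asymp_same_order (fun n => fine (P n (clique_event (G n) k)))
       (fun n => n%:R `^ (k%:R / 2 * (1 - k%:R)))) /\
  (alpha < k%:R ->
     asymp_same_order (fun n => fine (P n (clique_event (G n) k)))
       (fun n => n%:R `^ (k%:R / 2 * (1 - alpha)) *
                 l (Num.sqrt n%:R) ^+ k)).
Proof.
split.
  exact: (clique_asymp_k_lt_alpha halpha hk hl_pos hl hH htail hG).
exact: (clique_asymp_alpha_lt_k halpha hk hl_pos hl hH htail hG halphaZ).
Qed.
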